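(* Let $q=n(v-1)+1$ be a prime power (with $n,v$ positive integers) and let $k>2$. Assume that there exists a $1$-rotational $(R_{q,v-1},k,1)$ difference family all of whose base blocks are zero-sum in $\mathbb{F}_q$. Then there exists an $\mathrm{EA}(q)$-additive $(v,k,1)$-design.
   Context: A $(v,k,1)$-design is a pair $(V,\mathcal{B})$ with $V$ a $v$-set and $\mathcal{B}$ a collection of $k$-subsets of $V$ such that every pair of distinct points lies in exactly one block ($v>k>2$). $\mathrm{EA}(q)$ is the elementary abelian group of order $q$, i.e. the additive group of $\mathbb{F}_q$. A design is $\mathrm{EA}(q)$-additive if, up to isomorphism, its points are elements of $\mathrm{EA}(q)$ and every block sums to $0$. For $q\equiv 1 \pmod{m}$, $R_{q,m}$ is the subgroup of order $m$ of the multiplicative group $\mathbb{F}_q^*$. For a multiplicative group $G$ and a set $\mathcal{F}$ of subsets of $G$, the list of differences is the multiset of all ratios $xy^{-1}$ with $(x,y)$ an ordered pair of distinct elements of the same member of $\mathcal{F}$. For a subgroup $H$ of $G$, a $(G,H,k,1)$ difference family is a set of $k$-subsets of $G$ (base blocks) whose list of differences is exactly $G\setminus H$ (each element once). A $1$-rotational $(G,k,1)$ difference family is a $(G,H,k,1)$ difference family where $G$ is a cyclic group of order $v-1$ with $v\equiv k-1 \pmod{k(k-1)}$ and $H$ is the subgroup of $G$ of order $k-1$. *)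

(* Defs.v *)
From mathcomp Require Import all_boot all_order all_algebra all_fingroup all_solvable all_field.

Set Implicit Arguments.
Unset Strict Implicit.
Unset Printing Implicit Defensive.

Import GRing.Theory.

Section Designs.

Variables (P : finType) (blocks : {set {set P}}).

(* The point set is the whole finite type P. *)
Definition is_design (v k : nat) : Prop :=
  [/\ 2 < k < v,
      #|P| = v,
      forall b, b \in blocks -> #|b| = k &
      forall x y : P, x != y ->
        #|[set b in blocks | (x \in b) && (y \in b)]| = 1].

(* "Up to isomorphism" is the injective relabelling f of the points by
   elements of A; the relabelled points need not exhaust A. *)
Definition additive_design (A : finZmodType) : Prop :=
  exists2 f : P -> A, injective f &
    forall b, b \in blocks -> (\sum_(x in b) f x = 0)%R.

End Designs.

Section DifferenceFamilies.

Local Open Scope group_scope.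

Variable gT : finGroupType.
Implicit Types (G H : {group gT}) (fam : {set {set gT}}).

(* A multiset, represented as a sequence up to perm_eq. *)
Definition diff_list fam : seq gT :=
  flatten [seq [seq xy.1 * xy.2^-1 | xy <- enum (setX B B) & xy.1 != xy.2]
          | B <- enum fam].

Definition difference_family G H (k : nat) fam : Prop :=
  [/\ H \subset G,
      forall B, B \in fam -> B \subset G /\ #|B| = k &
      perm_eq (diff_list fam) (enum (G :\: H))].

(* With #|G| = v - 1 the congruence reads v - 1 = k - 1 modulo k (k - 1), as
   forced by counting the (v - 1) - (k - 1) differences.  A cyclic group has at
   most one subgroup of a given order, so H is determined by G and k. *)
Definition one_rotational_df G (k : nat) fam : Prop :=
  [/\ cyclic G,
      #|G| = k - 1 %[mod k * (k - 1)] &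
      exists2 H : {group gT}, H \subset G /\ #|H| = (k - 1)%N &
        difference_family G H k fam].

End DifferenceFamilies.

(* Base blocks live in the multiplicative group {unit F}, but are summed in the
   additive group of F. *)
Definition zero_sum (F : finFieldType) (B : {set {unit F}}) : Prop :=
  (\sum_(x in B) FinRing.uval x = 0 :> F)%R.

(* Main.v *)
Require Import Defs.
From mathcomp Require Import all_boot all_order all_algebra all_fingroup all_solvable all_field.

(** The group [R] acts on [R] together with [0] by multiplication.  The blocks
    are the translates of the base blocks and the cosets of [H] completed by
    [0].  A pair of points of [R] with ratio in [H] lies only in a completed
    coset; a pair with ratio outside [H] lies in exactly one translate, because
    the ratio occurs once in the list of differences.  Multiplying by an element
    of [R] preserves zero sums, and [H] is zero-sum since its sum is invariant
    under multiplication by some [h <> 1] in [H]. *)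

(** A coincidence of values in different members of [E] would repeat an entry across the
    concatenation, and one within a single member would repeat it there. Applied to the list of
    differences, this lets a ratio determine its base block and its ordered pair. *)
Lemma flatten_map_uniq_inj (I S T : eqType) (f : S -> T) (s : I -> seq S)
    (E : seq I) (i j : I) (x y : S) :
  uniq (flatten [seq [seq f z | z <- s l] | l <- E]) ->
  i \in E -> j \in E -> x \in s i -> y \in s j -> f x = f y ->
  i = j /\ x = y.
Proof.
have map_inj t u w : uniq (map f t) -> u \in t -> w \in t -> f u = f w -> u = w.
  elim: t => //= a t IHt /andP[fa_t Ut]; rewrite !inE.
  case/predU1P=> [->|t_u] /predU1P[->|t_w] // fuw; last exact: IHt.
    by rewrite fuw map_f in fa_t.
  by rewrite -fuw map_f in fa_t.
have flat_f l r z : l \in r -> z \in s l ->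
    f z \in flatten [seq [seq f z | z <- s l] | l <- r].
  move=> r_l s_z; apply/flattenP; exists [seq f z | z <- s l]; last exact: map_f.
  by apply/mapP; exists l.
elim: E => //= l E IHE; rewrite cat_uniq => /and3P[Ul /hasPn disj UE].
rewrite !inE => /predU1P[->|Ei] /predU1P[->|Ej] sx sy fxy.
- by split=> //; apply: map_inj Ul sx sy fxy.
- by have /negP[] := disj _ (flat_f _ _ _ Ej sy); rewrite /= -fxy map_f.
- by have /negP[] := disj _ (flat_f _ _ _ Ei sx); rewrite /= fxy map_f.
- exact: IHE.
Qed.

(** * The design developed from a difference family *)

Section DesignOfDifferenceFamily.

Set Implicit Arguments.
Unset Strict Implicit.

Local Open Scope group_scope.

Variables (gT : finGroupType) (G : {group gT}).

(* [None] stands for the fixed point of the 1-rotational action of [G]. *)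
Let point := option (subg_of G).

(** The flag [b] adjoins the fixed point, so that both kinds of block are handled by the same size
    and sum computations. *)
Definition ext_set (b : bool) (S : {set gT}) : {set point} :=
  [set p | if p is Some u then sgval u \in S else b].

Lemma ext_setE b (S : {set gT}) : S \subset G ->
  ext_set b S =
    (if b then [set None] else set0) :|: [set Some (subg G x) | x in S].
Proof.
move=> sSG; apply/setP=> -[u|]; rewrite !inE.
  have -> : (Some u \in (if b then [set None] else set0 : {set point})) = false.
    by case: b; rewrite inE.
  apply/idP/imsetP=> [Su | [x Sx [->]]]; first by exists (sgval u); rewrite ?sgvalK.
  by rewrite subgK ?(subsetP sSG).
have -> : (None \in [set Some (subg G x) | x in S]) = false.
  by apply/negP=> /imsetP[].
by case: b; rewrite !inE.
Qed.

Lemma big_ext_set (T : Type) (idx : T) (op : Monoid.com_law idx)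
    (F : point -> T) b (S : {set gT}) : S \subset G ->
  \big[op/idx]_(p in ext_set b S) F p =
    op (if b then F None else idx) (\big[op/idx]_(x in S) F (Some (subg G x))).
Proof.
move=> sSG; rewrite ext_setE // (eq_bigl _ _ (fun=> in_setU _ _ _)) bigU; last first.
  apply/pred0P=> p /=; apply/andP=> -[+ /imsetP[x _ Dp]].
  by rewrite Dp; case: b; rewrite inE.
congr (op _ _); first by case: b; rewrite ?big_set1 ?big_set0.
apply: big_imset => x y Sx Sy [/(congr1 sgval)].
by rewrite !subgK ?(subsetP sSG).
Qed.

Lemma card_ext_set b (S : {set gT}) : S \subset G ->
  #|ext_set b S| = (b + #|S|)%N.
Proof. by move=> sSG; rewrite -!sum1_card big_ext_set //; case: b. Qed.

Definition rotational_blocks (H : {group gT}) (fam : {set {set gT}}) :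
    {set {set point}} :=
  [set ext_set false (p.1 :* p.2) | p in setX fam G]
    :|: [set ext_set true (H :* x) | x in G].

Lemma rotational_blocksP (H : {group gT}) (fam : {set {set gT}}) (b : {set point}) :
  reflect ((exists B r, [/\ B \in fam, r \in G & b = ext_set false (B :* r)]) \/
           (exists2 x, x \in G & b = ext_set true (H :* x)))
          (b \in rotational_blocks H fam).
Proof.
rewrite inE; apply: (iffP orP) => -[].
- by case/imsetP=> -[B r]; rewrite inE => /andP[/= famB Gr ->]; left; exists B, r.
- by case/imsetP=> x Gx ->; right; exists x.
- case=> B [r [famB Gr ->]]; left; apply/imsetP.
  by exists (B, r); rewrite // inE famB.
- by case=> x Gx ->; right; apply: imset_f.
Qed.

Variables (H : {group gT}) (k : nat) (fam : {set {set gT}}).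
Hypothesis dfF : difference_family G H k fam.

Lemma mem_diff_list (d : gT) :
  reflect (exists B x y, [/\ B \in fam, x \in B, y \in B, x != y & d = x * y^-1])
          (d \in diff_list fam).
Proof.
apply: (iffP flattenP) => [[_ /mapP[B + ->] /mapP[[x y]]] |].
  rewrite mem_enum mem_filter mem_enum inE /=.
  by move=> famB /andP[xy /andP[Bx By]] ->; exists B, x, y.
case=> B [x [y [famB Bx By xy ->]]].
exists [seq xy.1 * xy.2^-1 | xy <- enum (setX B B) & xy.1 != xy.2].
  by apply/mapP; exists B; rewrite ?mem_enum.
by apply/mapP; exists (x, y); rewrite // mem_filter mem_enum inE /= xy Bx.
Qed.

Lemma df_ratio_notin B x y :
  B \in fam -> x \in B -> y \in B -> x != y -> x * y^-1 \notin H.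
Proof.
case: dfF => _ _ /perm_mem Dd famB Bx By xy.
have: x * y^-1 \in diff_list fam by apply/mem_diff_list; exists B, x, y.
by rewrite Dd mem_enum inE => /andP[].
Qed.

Lemma df_ratio_exists d : d \in G -> d \notin H ->
  exists B x y, [/\ B \in fam, x \in B, y \in B & d = x * y^-1].
Proof.
case: dfF => _ _ /perm_mem Dd Gd H'd.
have: d \in diff_list fam by rewrite Dd mem_enum inE H'd.
by case/mem_diff_list=> B [x [y [? ? ? _ ?]]]; exists B, x, y.
Qed.

(** The list of differences is a permutation of the enumeration of a set, hence free of
    repetitions. *)
Lemma df_ratio_inj B B' x y x' y' :
    B \in fam -> B' \in fam -> x \in B -> y \in B -> x' \in B' -> y' \in B' ->
    x != y -> x' != y' -> x * y^-1 = x' * y'^-1 ->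
  B = B' /\ x = x'.
Proof.
case: dfF => _ _ /perm_uniq; rewrite enum_uniq => Ud.
move=> famB famB' Bx By Bx' By' xy xy' Dxy.
have [] := @flatten_map_uniq_inj _ _ _ (fun u : gT * gT => u.1 * u.2^-1)
  (fun B : {set gT} => [seq u <- enum (setX B B) | u.1 != u.2]) _
  B B' (x, y) (x', y') Ud; rewrite ?mem_enum //=.
- by rewrite mem_filter mem_enum inE /= xy Bx.
- by rewrite mem_filter mem_enum inE /= xy' Bx'.
- by move=> -> [].
Qed.

Lemma rotational_design : 2 < k <= #|G| -> #|H| = (k - 1)%N ->
  is_design (rotational_blocks H fam) #|G|.+1 k.
Proof.
case: (dfF) => sHG famP _ /andP[k_gt2 lekG] oH.
have sBr B r : B \in fam -> r \in G -> B :* r \subset G.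
  by case/famP=> sBG _ Gr; rewrite mul_subG ?sub1set.
have sHx x : x \in G -> H :* x \subset G by move=> Gx; rewrite mul_subG ?sub1set.
split.
- by rewrite k_gt2.
- by rewrite card_option card_sub; congr _.+1; apply: eq_card.
- move=> b /rotational_blocksP[[B [r [famB Gr ->]]] | [x Gx ->]].
    by rewrite card_ext_set ?sBr // card_rcoset; case: (famP B).
  by rewrite card_ext_set ?sHx // card_rcoset oH subnKC // ltnW // ltnW.
move=> p p' pp'.
suff [b bP]: exists b, forall c : {set point},
    (c \in rotational_blocks H fam) && ((p \in c) && (p' \in c)) = (c == b).
  rewrite -[RHS](cards1 b); apply: eq_card => c.
  by rewrite [LHS]inE bP inE.
suff [b [bB bp bp' bU]]: exists b, [/\ b \in rotational_blocks H fam,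
    p \in b, p' \in b & forall c, c \in rotational_blocks H fam ->
    p \in c -> p' \in c -> c = b].
  exists b => c; apply/idP/eqP=> [/and3P[] | ->]; first exact: bU.
  by rewrite bB bp.
have coset_block (u : subg_of G) : ext_set true (H :* sgval u) \in rotational_blocks H fam.
  by apply/rotational_blocksP; right; exists (sgval u) => //; apply: subgP.
(* Only completed cosets contain the fixed point, and a coset is determined by any of its
   elements. *)
have fixed_unique (u : subg_of G) c : c \in rotational_blocks H fam ->
    None \in c -> Some u \in c -> c = ext_set true (H :* sgval u).
  case/rotational_blocksP=> [[B [r [_ _ ->]]] | [x _ ->]]; rewrite !inE //.
  by move=> _ /rcoset_eqP ->.
case: p p' pp' => [u|] [u'|] // uu'; last 1 first.
- exists (ext_set true (H :* sgval u')); split=> [|||c cB c0 cu].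
  + exact: coset_block.
  + by rewrite inE.
  + by rewrite inE rcoset_refl.
  + exact: fixed_unique.
- have neq : sgval u != sgval u' by apply: contraNneq uu' => /val_inj->.
  have [Gu Gu'] := (subgP u, subgP u').
  have [Hd | H'd] := boolP (sgval u * (sgval u')^-1 \in H).
    exists (ext_set true (H :* sgval u')); split.
    + exact: coset_block.
    + by rewrite inE mem_rcoset.
    + by rewrite inE rcoset_refl.
    move=> c; case/rotational_blocksP=> [[B [r [famB _ ->]]] | [x _ ->]]; rewrite !inE.
      (* Translating back by [r] keeps the ratio of [u] and [u'], which would then be a ratio of
         distinct elements of [B] and so lie outside [H]. *)
      rewrite !mem_rcoset => Bu Bu'.
      have := df_ratio_notin famB Bu Bu'; rewrite (can_eq (mulgK _)).
      by move/(_ neq)/negP; rewrite invMg invgK mulgA mulgKV.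
    by move=> _ /rcoset_eqP->.
  have [B [x [y [famB Bx By Dd]]]] := df_ratio_exists (groupM Gu (groupVr Gu')) H'd.
  have [sBG _] := famP B famB.
  have Gx := subsetP sBG x Bx; have Gy := subsetP sBG y By.
  have neqxy : x != y by apply: contraNneq H'd => xy; rewrite Dd xy mulgV.
  (* This translation carries [x] to [u]; it carries [y] to [u'] because the two pairs have the same
     ratio. *)
  exists (ext_set false (B :* (x^-1 * sgval u))); split.
  + by apply/rotational_blocksP; left; exists B, (x^-1 * sgval u); rewrite !groupM ?groupV.
  + by rewrite inE mem_rcoset invMg invgK mulgA mulgV mul1g.
  + rewrite inE mem_rcoset invMg invgK mulgA.
    suff -> : sgval u' * (sgval u)^-1 = y * x^-1 by rewrite mulgKV.
    by apply: invg_inj; rewrite !invMg !invgK.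
  move=> c /rotational_blocksP[[B' [r [famB' Gr ->]]] | [z _ ->]]; rewrite !inE.
    rewrite !mem_rcoset => B'u B'u'.
    (* Translated back by [r], the points [u] and [u'] form a pair of [B'] with the ratio of [x] and
       [y]. Hence [B' = B] and [u * r^-1 = x], which forces [r = x^-1 * u]. *)
    have [] := df_ratio_inj famB famB' Bx By B'u B'u' neqxy _ _.
    - by rewrite (can_eq (mulgK _)).
    - by rewrite -Dd invMg invgK mulgA mulgKV.
    by move=> -> ->; rewrite invMg invgK mulgKV.
  (* Two points in a common coset of [H] have their ratio in [H]. *)
  move=> /rcoset_eqP Du /rcoset_eqP Du'; case/negP: H'd.
  by rewrite -mem_rcoset Du' -Du rcoset_refl.
- exists (ext_set true (H :* sgval u)); split=> [|||c cB cu c0].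
  + exact: coset_block.
  + by rewrite inE rcoset_refl.
  + by rewrite inE.
  + exact: fixed_unique.
Qed.

End DesignOfDifferenceFamily.

(** * Zero sums under multiplication by units *)

Section ZeroSum.

Variable F : finFieldType.
Implicit Types (H : {group {unit F}}) (B : {set {unit F}}).

Local Open Scope ring_scope.

Lemma sum_uval_rcoset B (r : {unit F}) :
  \sum_(x in (B :* r)%g) FinRing.uval x
    = (\sum_(x in B) FinRing.uval x) * FinRing.uval r.
Proof.
rewrite -rcosetE big_imset ?GRing.mulr_suml //=.
by move=> x y _ _ /mulIg.
Qed.

Lemma zero_sum_rcoset B (r : {unit F}) : zero_sum B -> zero_sum (B :* r)%g.
Proof. by rewrite /zero_sum sum_uval_rcoset => ->; rewrite GRing.mul0r. Qed.

Lemma zero_sum_group H : (1 < #|H|)%N -> zero_sum H.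
Proof.
rewrite cardG_gt1 => /trivgPn[h Hh h_neq1]; rewrite /zero_sum.
have /eqP := sum_uval_rcoset H h; rewrite rcoset_id //.
(* With [S] the sum over [H], the equation [S = S * h] becomes [S * (1 - h) = 0] in a field. *)
rewrite -[X in X == _]GRing.mulr1 -GRing.subr_eq0 -GRing.mulrBr GRing.mulf_eq0.
case/orP=> [/eqP// | ]; rewrite GRing.subr_eq0 => /eqP h1.
by case/eqP: h_neq1; apply: val_inj.
Qed.

End ZeroSum.

Theorem theorem2p4 (q n v k : nat) (F : finFieldType) (R : {group {unit F}})
    (hn : 0 < n) (hv : 0 < v) (hk : 2 < k) (hkv : k < v)
    (hF : #|F| = q) (hq : q = n * (v - 1) + 1)
    (hR : #|R| = v - 1)
    (hDF : exists2 fam : {set {set {unit F}}},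
             one_rotational_df R k fam &
             forall B, B \in fam -> zero_sum B) :
  exists (P : finType) (blocks : {set {set P}}),
    is_design blocks v k /\ additive_design blocks F.
Proof.
case: hDF => fam [_ _ [H [sHR oH] dfF]] fam0.
exists (option (subg_of R)), (rotational_blocks R H fam).
have Dv : v = #|R|.+1 by rewrite hR subn1 prednK.
split; first by rewrite Dv; apply: rotational_design => //; rewrite hk -ltnS -Dv.
(* The fixed point is labelled by [0], which no unit equals, so the labelling is injective. *)
pose f (p : option (subg_of R)) : F :=
  if p is Some u then FinRing.uval (sgval u) else 0%R.
exists f.
  have uval0 (u : {unit F}) : FinRing.uval u <> 0%R.
    by move=> u0; have: FinRing.uval u \is a GRing.unit := valP u; rewrite u0 GRing.unitr0.
  case=> [u|] [u'|] //=; first by move/val_inj/val_inj->.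
    by move/uval0.
  by move/esym/uval0.
(* Adjoining the fixed point adds [0] to the sum, whatever the flag [z]. *)
have sum_f z (S : {set {unit F}}) : S \subset R -> zero_sum S ->
    (\sum_(p in ext_set R z S) f p = 0)%R.
  move=> sSR S0; rewrite big_ext_set //= (_ : (if z then _ else _) = 0%R).
    rewrite GRing.add0r -[RHS]S0; apply: eq_bigr => x Sx.
    by rewrite /f subgK ?(subsetP sSR).
  by case: z.
have [_ famP _] := dfF.
move=> b /rotational_blocksP[[B [r [famB Rr ->]]] | [x Rx ->]]; apply: sum_f.
- by rewrite mul_subG ?sub1set //; case: (famP B).
- by apply: zero_sum_rcoset; apply: fam0.
- by rewrite mul_subG ?sub1set.
(* Here [k > 2] ensures that [H], of order [k - 1], is nontrivial. *)
- by apply: zero_sum_rcoset; apply: zero_sum_group; rewrite oH ltn_subRL.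
Qed.
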